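(* Let $A$ be a simple algebra over a field $K$ with a finite dimensional filtration $F=\{A_i\}_{i\ge 0}$, and let $\mathrm{d}(A)$ denote any one of the four filter-type dimensions $\mathrm{fd}(A)$, $\mathrm{lfd}(A)$, $\mathrm{ud}(A)$, $\mathrm{lud}(A)$ of $A$ with respect to $F$. Then $$\mathrm{Dim}(M)\ \ge\ \frac{\mathrm{Dim}(A)}{\mathrm{d}(A)+\max\{\mathrm{d}(A),1\}}$$ for all nonzero finitely generated $A$-modules $M$.
   Context: Algebras are associative unital over an arbitrary field $K$, not necessarily finitely generated or Noetherian; modules are left modules. $\mathbb N=\{0,1,\dots\}$. For $f:\mathbb N\to\mathbb N$ its degree is $\gamma(f):=\inf\{r\in\mathbb R,\ r\ge 0 : f(i)\le i^r \text{ for } i\gg 0\}\in[0,\infty]$. A finite dimensional filtration $F=\{A_i\}_{i\ge0}$ on $A$ is a chain of finite dimensional subspaces $A_0\subseteq A_1\subseteq\cdots$ with $\bigcup_i A_i=A$, $K\subseteq A_0$, $A_iA_j\subseteq A_{i+j}$. $\mathrm{Dim}(A):=\gamma(i\mapsto\dim_K A_i)$. For a finitely generated module $M=AM_0$ with $\dim_K M_0<\infty$, put $M_i:=A_iM_0$ and $\mathrm{Dim}(M):=\gamma(i\mapsto\dim_K M_i)$ (independent of $M_0$). For a simple algebra $A$ with group of units $U(A)$ define, for $i\ge 0$ (with $XaY$ denoting the linear span of the elements $xay$, $x\in X,y\in Y$): $\nu_F(i):=\min\{j : 1\in A_jaA_j \text{ for all } 0\ne a\in A_i\}$, $\lambda_F(i):=\min\{j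 : 1\in AaA_j \text{ for all } 0\neq a\in A_i\}$, $\nu^u_F(i):=\min\{j : U(A)\cap A_jaA_j\ne\emptyset \text{ for all } 0\ne a\in A_i\}$, $\lambda^u_F(i):=\min\{j : U(A)\cap AaA_j\ne\emptyset \text{ for all } 0\ne a\in A_i\}$. It is a standing assumption that these four functions take only finite values. Then $\mathrm{fd}(A)=\gamma(\nu_F)$ (filter dimension), $\mathrm{lfd}(A)=\gamma(\lambda_F)$ (left filter dimension), $\mathrm{ud}(A)=\gamma(\nu_F^u)$ (unit dimension), $\mathrm{lud}(A)=\gamma(\lambda_F^u)$ (left unit dimension). Conventions for values in $[0,\infty]$: $a/\infty=0$ for finite $a$, $\infty/b=\infty$ for finite $b>0$; the inequality is asserted when the right-hand side is defined. *)

(* Defs.v *)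
From HB Require Import structures.
From mathcomp Require Export all_boot all_order all_algebra.
From mathcomp Require Export all_classical all_reals all_analysis.

Set Implicit Arguments.
Unset Strict Implicit.
Unset Printing Implicit Defensive.

Import Order.TTheory GRing.Theory Num.Theory.
Import numFieldNormedType.Exports.

Local Open Scope classical_set_scope.
Local Open Scope ring_scope.

Section LinearAlgebra.
Context {K : fieldType} {V : lmodType K}.

Definition spanK (S : set V) : set V :=
  [set v | exists n (c : 'I_n -> K) (s : 'I_n -> V),
     (forall i, S (s i)) /\ v = \sum_(i < n) c i *: s i].

Definition is_basis (n : nat) (b : 'I_n -> V) (W : set V) : Prop :=
  (forall c : 'I_n -> K, \sum_(i < n) c i *: b i = 0 -> forall i, c i = 0) /\
  W = spanK (range b).

(* In particular W is a linear subspace. *)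
Definition fin_dim (W : set V) : Prop :=
  exists n (b : 'I_n -> V), is_basis b W.

(* Junk value 0 when W is not a finite dimensional subspace. *)
Definition dimK (W : set V) : nat :=
  xget 0%N [set n | exists b : 'I_n -> V, is_basis b W].

End LinearAlgebra.

(* An A-module seen as a K-vector space, by restriction of scalars along
   K -> A. *)
Definition restr (K : fieldType) (A : algType K) (M : lmodType A) : Type := M.

Section Restriction.
Variables (K : fieldType) (A : algType K) (M : lmodType A).

HB.instance Definition _ := GRing.Zmodule.copy (restr M) M.

Definition restr_scale (k : K) (m : restr M) : restr M := k%:A *: (m : M).

Fact restr_scaleA a b v :
  restr_scale a (restr_scale b v) = restr_scale (a * b) v.
Proof. by rewrite /restr_scale scalerA -scalerAl mul1r scalerA. Qed.

Fact restr_scale1 : left_id 1 restr_scale.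
Proof. by move=> v; rewrite /restr_scale !scale1r. Qed.

Fact restr_scaleDr : right_distributive restr_scale +%R.
Proof. by move=> a u v; rewrite /restr_scale scalerDr. Qed.

Fact restr_scaleDl v : {morph restr_scale^~ v : a b / a + b}.
Proof. by move=> a b; rewrite /restr_scale !scalerDl. Qed.

HB.instance Definition _ := GRing.Zmodule_isLmodule.Build K (restr M)
  restr_scaleA restr_scale1 restr_scaleDr restr_scaleDl.

End Restriction.

(* The infimum of the empty set is +oo. *)
Definition degree (R : realType) (f : nat -> nat) : \bar R :=
  ereal_inf [set r%:E | r in
    [set r : R | 0 <= r /\ \forall i \near \oo, (f i)%:R <= i%:R `^ r]].

(* Junk value 0 when P is empty. *)
Definition nat_min (P : set nat) : nat :=
  xget 0%N [set n | P n /\ forall m, P m -> (n <= m)%N].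

Section Algebras.
Context {K : fieldType} {A : algType K}.

Definition two_sided_ideal (I : set A) : Prop :=
  [/\ I 0, forall x y, I x -> I y -> I (x + y) &
      forall a x, I x -> I (a * x) /\ I (x * a)].

(* 1 != 0 is part of algType. *)
Definition simple_algebra : Prop :=
  forall I : set A, two_sided_ideal I -> I = [set 0] \/ I = [set: A].

Definition units : set A := [set u | exists v, u * v = 1 /\ v * u = 1].

Record fd_filtration (F : nat -> set A) : Prop := {
  filtration_fin_dim : forall i, fin_dim (F i);
  filtration_mono : forall i, F i `<=` F i.+1;
  filtration_cover : \bigcup_i F i = [set: A];
  filtration_scalar : forall k : K, F 0%N k%:A;
  filtration_mul : forall i j a b, F i a -> F j b -> F (i + j)%N (a * b)
}.

Definition sandwich (X : set A) (a : A) (Y : set A) : set A :=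
  spanK [set x * a * y | x in X & y in Y].

Variable F : nat -> set A.

Definition nu_set (i : nat) : set nat :=
  [set j | forall a, F i a -> a != 0 -> sandwich (F j) a (F j) 1].

Definition lambda_set (i : nat) : set nat :=
  [set j | forall a, F i a -> a != 0 -> sandwich [set: A] a (F j) 1].

Definition nu_u_set (i : nat) : set nat :=
  [set j | forall a, F i a -> a != 0 ->
     units `&` sandwich (F j) a (F j) !=set0].

Definition lambda_u_set (i : nat) : set nat :=
  [set j | forall a, F i a -> a != 0 ->
     units `&` sandwich [set: A] a (F j) !=set0].

Definition filter_functions_finite : Prop :=
  forall i, [/\ nu_set i !=set0, lambda_set i !=set0,
                nu_u_set i !=set0 & lambda_u_set i !=set0].

Variable R : realType.

Definition Dim_alg : \bar R := degree R (fun i => dimK (F i)).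

Definition fd : \bar R := degree R (fun i => nat_min (nu_set i)).
Definition lfd : \bar R := degree R (fun i => nat_min (lambda_set i)).
Definition ud : \bar R := degree R (fun i => nat_min (nu_u_set i)).
Definition lud : \bar R := degree R (fun i => nat_min (lambda_u_set i)).

Variable M : lmodType A.

Definition act_span (X : set A) (M0 : set (restr M)) : set (restr M) :=
  spanK [set (a *: (m : M) : restr M) | a in X & m in M0].

Definition fin_generates (M0 : set (restr M)) : Prop :=
  fin_dim M0 /\ act_span [set: A] M0 = [set: restr M].

Definition Dim_mod (M0 : set (restr M)) : \bar R :=
  degree R (fun i => dimK (act_span (F i) M0)).

End Algebras.

Arguments simple_algebra {K} A.
Arguments Dim_mod {K A} F R {M} M0.

(* Main.v *)
(* Put M_i = A_i M_0 and let j be the value at i of any of the four filter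
   functions. A nonzero a in A_i cannot kill M_N for N >= j: some unit of A lies
   in A a A_j, and it would kill M_0. Hence A_i embeds into
   Hom_K(M_N, M_(i + N)), so dim A_i <= dim M_N * dim M_(i + N). Taking N of
   size i^s with s > d(A) and comparing growth gives
   Dim(A) <= Dim(M) (d(A) + max(d(A), 1)). *)
Require Import Defs.
From mathcomp Require Import ring lra.
Import Order.TTheory GRing.Theory Num.Theory.
Import numFieldNormedType.Exports.
Local Open Scope classical_set_scope.
Local Open Scope ring_scope.

Set Implicit Arguments.
Unset Strict Implicit.
Unset Printing Implicit Defensive.

(** * Linear spans *)

Section Span.
Context {K : fieldType} {V : lmodType K}.
Implicit Types S T : set V.

Lemma spanK_ext S : S `<=` spanK S.
Proof.
by move=> v Sv; exists 1%N, (fun=> 1), (fun=> v); rewrite big_ord1 scale1r.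
Qed.

Lemma spanK0 S : spanK S 0.
Proof.
exists 0%N, (fun=> 0), (fun=> 0); split; last by rewrite big_ord0.
by case.
Qed.

Lemma spanKZ S (k : K) v : spanK S v -> spanK S (k *: v).
Proof.
move=> [n [c [s [Ss ->]]]]; exists n, (fun i => k * c i), s; split => //.
by rewrite scaler_sumr; under eq_bigr do rewrite scalerA.
Qed.

Lemma spanKD S v w : spanK S v -> spanK S w -> spanK S (v + w).
Proof.
move=> [n [c [s [Ss ->]]]] [m [c' [s' [Ss' ->]]]].
exists (n + m)%N,
  (fun i : 'I_(n + m) =>
     match fintype.split i with inl j => c j | inr j => c' j end),
  (fun i : 'I_(n + m) =>
     match fintype.split i with inl j => s j | inr j => s' j end).
split=> [i|]; first by case: fintype.split.
rewrite big_split_ord /=; congr (_ + _); apply: eq_bigr => i _.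
  by rewrite (unsplitK (inl i)).
by rewrite (unsplitK (inr i)).
Qed.

Lemma spanK_sum S (I : finType) (v : I -> V) :
  (forall i, spanK S (v i)) -> spanK S (\sum_i v i).
Proof.
move=> Sv; elim/big_rec: _ => [|i w _ Sw]; first exact: spanK0.
exact: spanKD.
Qed.

Lemma spanK_min S T : S `<=` spanK T -> spanK S `<=` spanK T.
Proof.
move=> ST v [n [c [s [Ss ->]]]]; apply: spanK_sum => i; apply: spanKZ.
exact: ST.
Qed.

Lemma spanKS S T : S `<=` T -> spanK S `<=` spanK T.
Proof. by move=> ST; apply: spanK_min => v /ST /spanK_ext. Qed.

(** Generators may repeat in an element of [spanK]; adding up the coefficients of the terms that
    share an index leaves one coefficient per index. *)
Lemma spanK_range (I : finType) (b : I -> V) v :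
  spanK (range b) v -> exists c : I -> K, v = \sum_i c i *: b i.
Proof.
move=> [n [c [s [bs ->]]]].
have /choice[f bf] j : exists i, b i = s j by have [i] := bs j; exists i.
exists (fun i => \sum_(j < n | f j == i) c j).
under [RHS]eq_bigr do rewrite scaler_suml.
rewrite (partition_big f xpredT) //=; apply: eq_bigr => i _.
by apply: eq_bigr => j /eqP <-; rewrite bf.
Qed.

End Span.

(** * Linear systems, bases and dimension *)

Lemma homogeneous_solution (K : fieldType) n (I : finType)
    (X : 'I_n -> I -> K) :
  (#|I| < n)%N ->
  exists c : 'I_n -> K,
    (exists i, c i != 0) /\ forall t, \sum_i c i * X i t = 0.
Proof.
move=> ltIn; pose B := \matrix_(i < n, j < #|I|) X i (enum_val j).
(* With more rows than columns, the rank is below the number of rows, so the left kernel is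
   nonzero. *)
have kB : kermx B != 0.
  rewrite kermx_eq0 -row_leq_rank -ltnNge.
  exact: leq_ltn_trans (rank_leq_col B) ltIn.
have [i [j kij]] : exists i j, kermx B i j != 0.
  apply: contrapT => k0; move/eqP: kB; apply; apply/matrixP => i j.
  rewrite [RHS]mxE; apply: contrapT => /eqP kij; apply: k0; by exists i, j.
exists (kermx B i); split; first by exists j.
move=> t; have /matrixP/(_ i (enum_rank t)) := mulmx_ker B.
rewrite [RHS]mxE mxE => kB0; apply: etrans kB0; apply: eq_bigr => h _.
by rewrite [B _ _]mxE enum_rankK.
Qed.

Section Dimension.
Context {K : fieldType} {V : lmodType K}.
Implicit Types W : set V.

Lemma dimKP W : fin_dim W -> exists b : 'I_(dimK W) -> V, is_basis b W.
Proof. exact: xgetPex. Qed.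

Lemma fin_dim_span_ord n (s : 'I_n -> V) : fin_dim (spanK (range s)).
Proof.
elim: n s => [|n IH] s; first by exists 0%N, s; split => // c _ [].
have [ind|] := pselect (forall c : 'I_n.+1 -> K,
    \sum_(i < n.+1) c i *: s i = 0 -> forall i, c i = 0).
  by exists n.+1, s.
move=> /existsNP[c /not_implyP[c0 /existsNP[i /eqP ci]]].
suff -> : spanK (range s) = spanK (range (s \o lift i)) by exact: IH.
apply/seteqP; split; apply: spanK_min; last first.
  by move=> _ [j _ <-]; apply: spanK_ext; exists (lift i j).
move=> _ [j _ <-]; have [k ->|->] := unliftP i j.
  by apply: spanK_ext; exists k.
have -> : s i = - (c i)^-1 *: \sum_(k < n) c (lift i k) *: s (lift i k).
  move: c0; rewrite (bigD1_ord i) //= => /eqP; rewrite addr_eq0 => /eqP c0.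
  by rewrite scaleNr -scalerN -c0 scalerA mulVf // scale1r.
apply: spanKZ; apply: spanK_sum => k; apply: spanKZ; apply: spanK_ext.
by exists k.
Qed.

Lemma fin_dim_span (I : finType) (s : I -> V) : fin_dim (spanK (range s)).
Proof.
suff -> : range s = range (fun i : 'I_#|I| => s (enum_val i)).
  exact: fin_dim_span_ord.
apply/seteqP; split => _ [i _ <-]; last by exists (enum_val i).
by exists (enum_rank i) => //; rewrite enum_rankK.
Qed.

End Dimension.


Lemma linear_comb (K : fieldType) (V V' : lmodType K) (f : V -> V')
    (I : finType) (c : I -> K) (v : I -> V) :
  linear f -> f (\sum_i c i *: v i) = \sum_i c i *: f (v i).
Proof.
move=> fl; have f0 : f 0 = 0.
  by have := fl (-1) 0 0; rewrite scaler0 addr0 scaleN1r addNr.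
elim: (index_enum I) => [|i r IH]; first by rewrite !big_nil.
by rewrite !big_cons fl IH.
Qed.

(* The last hypothesis says that W embeds into Hom(U, U'). *)
Lemma dimK_le_hom (K : fieldType) (E V V' : lmodType K) (f : E -> V -> V')
    (W : set E) (U : set V) (U' : set V') :
  (forall v, linear (f^~ v)) -> (forall a, linear (f a)) ->
  fin_dim W -> fin_dim U -> fin_dim U' ->
  (forall a v, W a -> U v -> U' (f a v)) ->
  (forall a, W a -> (forall v, U v -> f a v = 0) -> a = 0) ->
  (dimK W <= dimK U * dimK U')%N.
Proof.
move=> fl fr /dimKP[a [ia Wa]] /dimKP[u [_ Uu]] /dimKP[w [_ U'w]] fU' inj.
have spanW x : spanK (range a) x -> W x by rewrite -Wa.
have spanU v : U v -> spanK (range u) v by rewrite -Uu.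
have aW i : W (a i) by apply: spanW; apply: spanK_ext; exists i.
have uU i : U (u i) by rewrite Uu; apply: spanK_ext; exists i.
rewrite leqNgt; apply/negP => lt.
have /choice[X fE] (il : 'I_(dimK W) * 'I_(dimK U)) :
    exists x : 'I_(dimK U') -> K, f (a il.1) (u il.2) = \sum_h x h *: w h.
  by apply: spanK_range; rewrite -U'w; apply: fU'.
(* [X] holds the coordinates of [f (a i) (u l)] in the basis [w]. There is one unknown per basis
   vector of [W] and one equation per pair of basis vectors of [U] and [U']; a nontrivial solution
   is a combination of the [a i] that kills [U]. *)
have [|c [[i ci] cX]] := homogeneous_solution
    (fun i (lh : 'I_(dimK U) * 'I_(dimK U')) => X (i, lh.1) lh.2).
  by rewrite card_prod !card_ord.
move/eqP: ci; apply; apply: ia; apply: inj.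
  apply: spanW; apply: spanK_sum => j; apply: spanKZ; apply: spanK_ext.
  by exists j.
move=> v /spanU /spanK_range[y ->].
rewrite linear_comb // big1 // => l _.
rewrite (linear_comb (f := f^~ _)) //.
under eq_bigr do rewrite (fE (_, l)) scaler_sumr.
rewrite exchange_big big1 ?scaler0 //= => h _.
under eq_bigr do rewrite scalerA.
by rewrite -scaler_suml (cX (l, h)) scale0r.
Qed.

(** * Action of the filtration on the module *)

Section FilteredModule.
Variables (K : fieldType) (A : algType K) (F : nat -> set A).
Hypothesis filtF : fd_filtration F.
Variables (M : lmodType A) (M0 : set (restr M)).

(** The action is typed on [restr M] so that its linearity over [K] can be stated. *)
Definition act (a : A) (m : restr M) : restr M := a *: (m : M).

Lemma act_linearl (m : restr M) : linear (act^~ m).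
Proof.
move=> k a b; rewrite /act scalerDl; congr (_ + _).
change ((k *: a) *: (m : M) = k%:A *: (a *: (m : M))).
by rewrite scalerA -scalerAl mul1r.
Qed.

Lemma act_linearr (a : A) : linear (act a).
Proof.
move=> k m m'; rewrite /act scalerDr; congr (_ + _).
(* Scaling by [k] is the action of [k%:A], which commutes with [a]. *)
change (a *: (k%:A *: (m : M)) = k%:A *: (a *: (m : M))).
by rewrite !scalerA -scalerAl mul1r -scalerAr mulr1.
Qed.

Lemma filtration_le i j : (i <= j)%N -> F i `<=` F j.
Proof.
move=> /subnK <-; elim: (j - i)%N => // n IH x /IH.
exact: filtration_mono.
Qed.

Lemma act_span_le i j : (i <= j)%N -> act_span (F i) M0 `<=` act_span (F j) M0.
Proof.
move=> ij; apply: spanKS => _ [a /(filtration_le ij) Fa [m Mm <-]].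
by exists a => //; exists m.
Qed.

(** The products of a basis of [F i] with a basis of [M0] form a finite spanning family. *)
Lemma act_span_fin_dim i : fin_dim M0 -> fin_dim (act_span (F i) M0).
Proof.
move=> [p [u [_ Mu]]]; have [n [a [_ Fa]]] := filtration_fin_dim filtF i.
suff -> : act_span (F i) M0 =
    spanK (range (fun jl : 'I_n * 'I_p => act (a jl.1) (u jl.2))).
  exact: fin_dim_span.
apply/seteqP; split; apply: spanK_min.
  move=> _ [x + [m + <-]]; rewrite Fa Mu.
  move=> /spanK_range[c ->] /spanK_range[d ->].
  rewrite -/(act _ _) linear_comb; last exact: act_linearr.
  apply: spanK_sum => l; apply: spanKZ.
  rewrite (linear_comb (f := act^~ _)); last exact: act_linearl.
  by apply: spanK_sum => j; apply: spanKZ; apply: spanK_ext; exists (j, l).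
move=> _ [[j l] _ <-]; apply: spanK_ext; exists (a j).
  by rewrite Fa; apply: spanK_ext; exists j.
by exists (u l) => //; rewrite Mu; apply: spanK_ext; exists l.
Qed.

Lemma act_span_act i j a m :
  F i a -> act_span (F j) M0 m -> act_span (F (i + j)) M0 (act a m).
Proof.
move=> Fa [n [c [s [Ms ->]]]]; rewrite linear_comb; last exact: act_linearr.
apply: spanK_sum => k; apply: spanKZ; apply: spanK_ext.
have [x Fx [u Mu <-]] := Ms k; exists (a * x).
  exact: (filtration_mul filtF).
by exists u => //; rewrite /act scalerA.
Qed.

Hypothesis M_neq0 : exists m : M, m != 0.
Hypothesis genM : fin_generates M0.

(* If a kills A_j M_0, then so does the unit in A a A_j; hence M_0 = 0. *)
Lemma act_span_faithful i j a : lambda_u_set F i j -> F i a ->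
  (forall m, act_span (F j) M0 m -> act a m = 0) -> a = 0.
Proof.
move=> lij Fa aM; apply/eqP; apply: contrapT => /negP a0.
have [u [[v [_ vu]] [n [c [s [sE uE]]]]]] := lij a Fa a0.
have M00 m : M0 m -> m = 0.
  move=> Mm; have um : act u m = 0.
    rewrite uE (linear_comb (f := act^~ m)); last exact: act_linearl.
    (* Each term is a multiple of [x * a * y] with [y] in [F j], so [y] sends [m] into the subspace
       that [a] kills. *)
    rewrite big1 // => k _; have [x _ [y Fy <-]] := sE k.
    suff -> : act (x * a * y) m = 0 by rewrite scaler0.
    rewrite /act -!scalerA -/(act a (act y m)) aM ?scaler0 //.
    by apply: spanK_ext; exists y => //; exists m.
  by rewrite -[m](scale1r (m : M)) -vu -scalerA -/(act u m) um scaler0.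
(* If [M0] contains only 0, the module it generates is 0. *)
have [m /eqP] := M_neq0; apply.
have : [set: restr M] m by [].
rewrite -(genM.2) => -[p [d [t [tE ->]]]]; rewrite big1 // => k _.
have [x _ [y /M00 -> <-]] := tE k.
by rewrite scaler0 scaler0.
Qed.

Lemma dimK_filtration_le i j N : lambda_u_set F i j -> (j <= N)%N ->
  (dimK (F i) <= dimK (act_span (F N) M0) * dimK (act_span (F (i + N)) M0))%N.
Proof.
move=> lij jN; apply: (@dimK_le_hom _ _ _ _ act).
- exact: act_linearl.
- exact: act_linearr.
- exact: filtration_fin_dim.
- exact: act_span_fin_dim genM.1.
- exact: act_span_fin_dim genM.1.
- by move=> a m Fa Mm; apply: act_span_act.
(* An element that kills A_N M_0 kills the smaller subspace A_j M_0, where faithfulness is known. *)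
- move=> a Fa aM; apply: (act_span_faithful lij Fa) => m Mm.
  by apply: aM; apply: act_span_le Mm.
Qed.

End FilteredModule.

(** * Comparison of the four filter functions *)

Lemma nat_minP (P : set nat) : P !=set0 -> P (nat_min P).
Proof.
move=> [n Pn]; rewrite /nat_min; case: xgetP => [m _ []//|] noP.
(* The default branch of [xget] is impossible, since a nonempty set of naturals has a least
   element. *)
have exP : exists m, `[< P m >] by exists n; apply/asboolP.
case: (ex_minnP exP) => m /asboolP Pm mmin.
by case: (noP m); split => // k Pk; apply: mmin; apply/asboolP.
Qed.

Section FilterFunctions.
Variables (K : fieldType) (A : algType K) (F : nat -> set A) (i : nat).

Lemma sandwichS (X X' Y : set A) a : X `<=` X' ->
  sandwich X a Y `<=` sandwich X' a Y.
Proof.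
move=> XX'; apply: spanKS => _ [x Xx [y Yy <-]].
by exists x; [exact: XX'|exists y].
Qed.

Lemma units1 : units (1 : A).
Proof. by exists 1; rewrite mulr1. Qed.

(** 1 is a unit, and replacing the left factor [F j] by all of [A] enlarges the sandwich. With the
    next two inclusions, an estimate for [lambda_u_set] serves all four dimensions. *)
Lemma nu_set_sub : nu_set F i `<=` lambda_u_set F i.
Proof.
move=> j nuj a Fa a0; exists 1; split; first exact: units1.
by apply: sandwichS (nuj a Fa a0).
Qed.

Lemma lambda_set_sub : lambda_set F i `<=` lambda_u_set F i.
Proof. by move=> j lj a Fa a0; exists 1; split; [exact: units1|exact: lj]. Qed.

Lemma nu_u_set_sub : nu_u_set F i `<=` lambda_u_set F i.
Proof.
move=> j nuj a Fa a0; have [u [Uu su]] := nuj a Fa a0.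
by exists u; split => //; apply: sandwichS su.
Qed.

End FilterFunctions.

(** * Growth of functions and their degrees *)

Section Degree.
Variable R : realType.
Implicit Types (f : nat -> nat) (r s t : R).

Lemma degree_ge0 f : (0 <= degree R f)%E.
Proof. by apply: le_ereal_inf_tmp => _ [r [r0 _] <-]; rewrite lee_fin. Qed.

(** Some admissible exponent lies below [r], and i^r increases with the exponent once i >= 1. *)
Lemma degree_lt f r : (degree R f < r%:E)%E ->
  \forall i \near \oo, (f i)%:R <= i%:R `^ r.
Proof.
move=> /ereal_inf_lt[_ [r' [r'0 fr'] <-]]; rewrite lte_fin => /ltW r'r.
near=> i; apply: (@le_trans _ _ (i%:R `^ r')); first by near: i.
apply: ler_powR => //; rewrite ler1n; near: i; exact: nbhs_infty_gt.
Unshelve. all: by end_near. Qed.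

Lemma powR_near_ge (C t : R) : 0 < t -> \forall i \near \oo, C <= i%:R `^ t.
Proof.
move=> t0; near=> i; have [/ltW C0|C0] := ltP C 0.
  by rewrite (le_trans C0) ?powR_ge0.
have -> : C = (C `^ t^-1) `^ t by rewrite -powRrM mulVf ?lt0r_neq0 // powRr1.
apply: ge0_ler_powR; rewrite ?nnegrE ?powR_ge0 ?(ltW t0) //.
near: i; exact: nbhs_infty_ger.
Unshelve. all: by end_near. Qed.

(** For every e > 0 the factor i^e eventually exceeds [C], so t + e is an admissible exponent. *)
Lemma degree_le f (C t : R) : 0 <= t ->
  (\forall i \near \oo, (f i)%:R <= C * i%:R `^ t) -> (degree R f <= t%:E)%E.
Proof.
move=> t0 fC; apply/lee_addgt0Pr => e e0; rewrite -EFinD.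
apply: ereal_inf_lbound; exists (t + e) => //; split.
  by rewrite addr_ge0 // ltW.
near=> i; apply: (@le_trans _ _ (C * i%:R `^ t)); first by near: i.
rewrite powRD; last by rewrite gt_eqF // ltr_wpDl.
rewrite mulrC ler_wpM2l ?powR_ge0 //; near: i; exact: powR_near_ge.
Unshelve. all: by end_near. Qed.

Lemma degree_le_mul (a g m : nat -> nat) r s :
  (forall i N, (g i <= N)%N -> (a i <= m N * m (i + N))%N) ->
  (degree R g < s%:E)%E -> (degree R m < r%:E)%E ->
  (degree R a <= (r * (s + Num.max s 1))%:E)%E.
Proof.
move=> agm gs mr.
have s0 : 0 < s by rewrite -lte_fin (le_lt_trans (degree_ge0 g)).
have r0 : 0 < r by rewrite -lte_fin (le_lt_trans (degree_ge0 m)).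
have {}gs := degree_lt gs; have [N0 _ N0P] := degree_lt mr.
set x := Num.max s 1.
have x0 : 0 <= x by rewrite le_max ler01 orbT.
(* The constant comes from the bound i + N <= 2 i^x used for the second factor. *)
apply: (@degree_le _ (2 `^ r)); first by rewrite mulr_ge0 ?addr_ge0 // ltW.
near=> i; set N := Num.truncn (i%:R `^ s).
have i1 : 1 <= i%:R :> R by rewrite ler1n; near: i; exact: nbhs_infty_gt.
have i0 : 0 <= i%:R :> R by [].
have gN : (g i <= N)%N by rewrite truncn_ge_nat ?powR_ge0 //; near: i.
(* Since s > 0, N tends to infinity with i, so the growth bound on [m] applies at both N and i +
   N. *)
have N0N : (N0 <= N)%N.
  by rewrite truncn_ge_nat ?powR_ge0 //; near: i; exact: powR_near_ge.
have NE : N%:R <= i%:R `^ s by rewrite truncn_le powR_ge0.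
apply: (@le_trans _ _ ((m N)%:R * (m (i + N)%N)%:R)).
  by rewrite -natrM ler_nat agm.
apply: (@le_trans _ _ (N%:R `^ r * (i + N)%:R `^ r)).
  apply: ler_pM => //; apply: N0P => //=; exact: leq_trans N0N (leq_addl _ _).
have -> : 2 `^ r * i%:R `^ (r * (s + x)) =
    (i%:R `^ s) `^ r * (2 * i%:R `^ x) `^ r.
  rewrite powRM ?powR_ge0 // mulrCA -!powRrM -powRD; last first.
    by rewrite gt_eqF // ltr_wpDr ?mulr_gt0 // mulr_ge0 // ltW.
  by congr (_ * _ `^ _); ring.
apply: ler_pM; rewrite ?powR_ge0 //; apply: ge0_ler_powR;
  rewrite ?nnegrE ?mulr_ge0 ?powR_ge0 ?(ltW r0) //.
(* Both i and N are at most i^x, because x >= 1 and x >= s. *)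
rewrite natrD mulrDl mul1r lerD //.
  by rewrite -[leLHS]powRr1 // ler_powR // le_max lexx orbT.
by rewrite (le_trans NE) // ler_powR // le_max lexx.
Unshelve. all: by end_near. Qed.

Lemma degree_div_le (a g m : nat -> nat) :
  (forall i N, (g i <= N)%N -> (a i <= m N * m (i + N))%N) ->
  ~ (degree R a = +oo /\ degree R g = +oo)%E ->
  (degree R a / (degree R g + maxe (degree R g) 1) <= degree R m)%E.
Proof.
move=> agm nyy; have := @degree_le_mul _ _ _ _ _ agm.
move: nyy (degree_ge0 a) (degree_ge0 g) (degree_ge0 m).
(* Nonnegativity excludes -oo. The bound is trivial if [m] has infinite degree, and the quotient is
   0 if [g] has. *)
case: (degree R m) => [mu||]; [|by move=> *; rewrite leey|by []].
case: (degree R g) => [d||] nyy a0 d0 mu0 H; [|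
  by rewrite maxye addye // invey mule0|by []].
have maxE : maxe d%:E 1%E = (Num.max d 1)%:E by rewrite EFin_max.
rewrite maxE -EFinD; set D := d + Num.max d 1.
rewrite !lee_fin in d0 mu0.
have D1 : 1 <= D.
  by rewrite /D -[leLHS]add0r lerD // le_max lexx orbT.
have D0 : 0 < D by exact: lt_le_trans D1.
rewrite inver gt_eqF // lee_pdivrMr // -EFinM.
apply/lee_addgt0Pr => e e0.
(* The exponents mu + h and d + h give at most (mu + h)(D + 2h) = mu D + h(2 mu + D + 2h), which for
   h <= 1 is at most mu D + h B; hence the choice h <= e / B. *)
pose B := 2 * mu + D + 2.
have B0 : 0 < B by rewrite /B ltr_wpDl // addr_ge0 ?mulr_ge0 // ltW.
pose h := Num.min 1 (e / B).
have h0 : 0 < h by rewrite lt_min ltr01 divr_gt0.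
have h1 : h <= 1 by rewrite ge_min lexx.
have hB : h * B <= e by rewrite -ler_pdivlMr // ge_min lexx orbT.
apply: (le_trans (H (mu + h) (d + h) _ _)); rewrite ?lte_fin ?ltrDl //.
rewrite -EFinD lee_fin.
have : Num.max (d + h) 1 <= Num.max d 1 + h.
  rewrite ge_max lerD2r le_max lexx /=.
  by rewrite (@le_trans _ _ (Num.max d 1)) ?le_max ?lexx ?orbT // lerDl ltW.
move: D1 D0 B0 hB; rewrite /B /D; move: (Num.max d 1) (Num.max _ _) => x y.
move=> *; nra.
Qed.

End Degree.

Local Open Scope ereal_scope.

Theorem theorem1p3 (R : realType) (K : fieldType) (A : algType K)
    (F : nat -> set A)
    (simpleA : simple_algebra A)
    (filtF : fd_filtration F)
    (finF : filter_functions_finite F)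
    (d : \bar R)
    (hd : [\/ d = fd F R, d = lfd F R, d = ud F R | d = lud F R])
    (rhs_defined : ~ (Dim_alg F R = +oo /\ d = +oo))
    (M : lmodType A)
    (M_neq0 : exists m : M, m != 0%R)
    (M0 : set (restr M))
    (genM : fin_generates M0) :
  Dim_mod F R M0 >= Dim_alg F R / (d + maxe d 1).
Proof.
(* Whichever dimension [d] is, the values of its filter function lie in [lambda_u_set], so one
   argument covers the four cases. *)
have [g [dE gP]] : exists g, d = degree R g /\ forall i, lambda_u_set F i (g i).
  case: hd => ->; eexists; (split; first by []) => i;
    have [nu0 lam0 nuu0 lamu0] := finF i.
  - by apply: nu_set_sub; apply: nat_minP.
  - by apply: lambda_set_sub; apply: nat_minP.
  - by apply: nu_u_set_sub; apply: nat_minP.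
  - exact: nat_minP.
rewrite dE in rhs_defined *; apply: degree_div_le rhs_defined => i N gN.
exact: (dimK_filtration_le filtF M_neq0 genM (gP i) gN).
Qed.
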